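(* Let $\lambda\ge1$ be an integer and $X\sim\mathrm{Poi}(\lambda)$. Then, exactly, $$\log\frac{\mathbb E|X-\lambda|}{\sqrt{2\lambda/\pi}}=-J(\lambda)=\int_0^\infty\varphi(t)\bigl(-e^{-\lambda t}\bigr)\,dt .$$ Let $a_n(\theta)=-\frac{B_{n+1}(\theta)}{n(n+1)}$ for $n\ge1$ (the coefficients of the asymptotic series $\sum_{n\ge1}a_n(\theta)\lambda^{-n}$ of $\log\bigl(\mathbb E|X-\lambda|/\sqrt{2\lambda/\pi}\bigr)$, with $\theta=\{\lambda\}$). At $\theta=0$ this series collapses to the odd series $\sum_{j\ge1}a_{2j-1}(0)\lambda^{1-2j}$, i.e. $a_{2j}(0)=0$ for all $j\ge1$, with $$a_{2j-1}(0)=-\frac{B_{2j}}{(2j-1)\,2j},$$ and its successive partial sums strictly bracket $\log\bigl(\mathbb E|X-\lambda|/\sqrt{2\lambda/\pi}\bigr)$: for every integer $M\ge0$, $$(-1)^{M+1}\Bigl[\log\frac{\mathbb E|X-\lambda|}{\sqrt{2\lambda/\pi}}-\sum_{j=1}^{M}\frac{a_{2j-1}(0)}{\lambda^{2j-1}}\Bigr]>0 .$$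
   Context: $B_k(t)$ and $B_k=B_k(0)$ are the Bernoulli polynomials and numbers: $\frac{z e^{tz}}{e^z-1}=\sum_{k\ge0}B_k(t)\frac{z^k}{k!}$. $\mathrm{Poi}(\lambda)$ has mass function $e^{-\lambda}\lambda^k/k!$. The function $\varphi$ is $\varphi(t)=\frac1t\bigl(\frac1{e^t-1}-\frac1t+\frac12\bigr)$, $t>0$. $J$ is Binet's function, $J(x)=\int_0^\infty\varphi(t)e^{-xt}\,dt$ for $x>0$, which satisfies $\log\Gamma(x)=(x-\tfrac12)\log x-x+\tfrac12\log2\pi+J(x)$. $\{\lambda\}$ is the fractional part. *)

(* Defs.v *)
From HB Require Import structures.
From mathcomp Require Import all_boot all_order all_algebra.
From mathcomp Require Import all_classical all_reals all_analysis.
Import Order.TTheory GRing.Theory Num.Theory.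
Import numFieldNormedType.Exports.

Set Implicit Arguments.
Unset Strict Implicit.
Unset Printing Implicit Defensive.

Local Open Scope classical_set_scope.
Local Open Scope ring_scope.

(* The generating function determines every B k: two power series in z that
   agree on a punctured neighbourhood of 0 have the same coefficients, and the
   values (B k).[t] at all reals t determine the polynomial B k.  The point
   z = 0 is excluded because z / (expR z - 1) is a removable 0 / 0 there. *)
Definition bernoulli_polynomials (R : realType) (B : nat -> {poly R}) : Prop :=
  forall t : R, \forall z \near (0 : R)^',
    series (fun k => (B k).[t] * (z ^+ k / k`!%:R)) @ \oo -->
      z * expR (t * z) / (expR z - 1).

Definition bernoulli_number (R : realType) (B : nat -> {poly R}) (k : nat) : R :=
  (B k).[0].

(* The masses of [poisson_pmf rate] sum to 1, so X is almost surely a natural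
   number. *)
Definition poisson_distributed (d : measure_display) (T : measurableType d)
    (R : realType) (P : probability T R) (X : {RV P >-> R}) (rate : R) : Prop :=
  forall k : nat, pmf X k%:R = poisson_pmf rate k.

Definition varphi (R : realType) (t : R) : R :=
  t^-1 * ((expR t - 1)^-1 - t^-1 + 2^-1).

Definition binet (R : realType) (x : R) : \bar R :=
  (\int[lebesgue_measure]_(t in `]0%R, +oo[) (varphi t * expR (- (x * t)))%:E)%E.

(* An infinite expectation would give [fine] = 0 and hence the value ln 0 = 0. *)
Definition log_mad_ratio (d : measure_display) (T : measurableType d)
    (R : realType) (P : probability T R) (X : {RV P >-> R}) (lambda : R) : R :=
  ln (fine 'E_P[fun w => `|X w - lambda|] / Num.sqrt (2 * lambda / pi)).

Definition acoef (R : realType) (B : nat -> {poly R}) (n : nat) (theta : R) : R :=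
  - ((B n.+1).[theta] / (n * n.+1)%:R).

(* Main.v *)
(** Write [J] for [fine (binet _)].  Telescoping the Poisson weights [p k] gives
    [E|X - lambda| = 2 lambda p lambda], so the first claim is Stirling's formula
    with remainder [J lambda].  For it, [varphi t * (1 - exp (-t))] is the integral
    over [0 <= u <= 1] of [u (1 - u) / 2 * t * exp (-u t)], so Tonelli yields
    [J x - J (x + 1) = (x + 1/2) ln ((x + 1) / x) - 1]; hence
    [ln n! - (n + 1/2) ln n + n - J n] is constant, and Wallis' product gives its
    value.

    For the brackets, [t * varphi t + 1 / t = coth (t / 2) / 2] satisfies a Riccati
    equation, which determines numbers [c n > 0] by the convolution recurrence
    [(2 n + 5) c (n+1) = sum_(i <= n) c i * c (n - i)].  The remainders
    [r 0 = varphi], [r (n+1) = (c n - r n) / t^2] satisfy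
    [(t^(2n+5) r (n+1))' = t^(2n+4) (sum_(j < n) c j * r (n - j) + varphi * r n)],
    so they are all positive by induction.  Integrating
    [varphi = sum_(i < n) (-1)^i c i t^(2i) + (-1)^n t^(2n) r n] against
    [exp (-lambda t)] gives the enveloping expansion of [J], and the same identity
    as [t] tends to [0+] identifies the Bernoulli numbers:
    [B_(2j+2) = (2j+2)! (-1)^j c j]. *)

Require Import Defs.
From HB Require Import structures.
From mathcomp Require Import all_boot all_order all_algebra.
From mathcomp Require Import all_classical all_reals all_analysis.
From mathcomp Require Import measurable_realfun ring lra zify.
Import Order.TTheory GRing.Theory Num.Theory.
Import numFieldNormedType.Exports.

Local Open Scope classical_set_scope.
Local Open Scope ring_scope.

(** * Differentiation rules, and positivity from a positive derivative *)

Section derivation.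
Context {R : realType}.
Implicit Types (f g : R -> R) (x a b : R).

Lemma is_derive1D f g x a b : is_derive x 1 f a -> is_derive x 1 g b ->
  is_derive x 1 (fun y => f y + g y) (a + b).
Proof. by move=> ? ?; exact: is_deriveD. Qed.

Lemma is_derive1N f x a : is_derive x 1 f a ->
  is_derive x 1 (fun y => - f y) (- a).
Proof. by move=> ?; exact: is_deriveN. Qed.

Lemma is_derive1M f g x a b : is_derive x 1 f a -> is_derive x 1 g b ->
  is_derive x 1 (fun y => f y * g y) (f x * b + g x * a).
Proof. by move=> ? ?; exact: is_deriveM. Qed.

Lemma is_derive1X f n x a : is_derive x 1 f a ->
  is_derive x 1 (fun y => f y ^+ n) (n%:R * f x ^+ n.-1 * a).
Proof.
move=> df; rewrite (_ : (fun y => f y ^+ n) = f ^+ n); last by rewrite exprfctE.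
exact: is_deriveX.
Qed.

Lemma is_derive1V f x a : f x != 0 -> is_derive x 1 f a ->
  is_derive x 1 (fun y => (f y)^-1) (- (f x) ^- 2 * a).
Proof. by move=> f0 df; exact: is_deriveV. Qed.

Lemma is_derive1_expR_comp f x a : is_derive x 1 f a ->
  is_derive x 1 (fun y => expR (f y)) (expR (f x) * a).
Proof. by move=> df; exact: is_derive1_comp. Qed.

Lemma is_derive1_ln_comp f x a : 0 < f x -> is_derive x 1 f a ->
  is_derive x 1 (fun y => ln (f y)) ((f x)^-1 * a).
Proof.
by move=> f0 df; have lnf := is_derive1_ln f0; exact: is_derive1_comp.
Qed.

Lemma is_derive1_cst (c : R) x : is_derive x 1 (fun=> c) 0.
Proof. exact: is_derive_cst. Qed.

Lemma is_derive1_id x : is_derive x 1 (fun y => y) 1.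
Proof. exact: is_derive_id. Qed.

Lemma is_derive1_continuous f x a : is_derive x 1 f a -> {for x, continuous f}.
Proof.
by move=> [df _]; apply: differentiable_continuous; exact/derivable1_diffP.
Qed.

Lemma is_derive1_eq f x a b : is_derive x 1 f a -> a = b -> is_derive x 1 f b.
Proof. by move=> + <-. Qed.

Lemma is_derive1_gt0_gt0 f (df : R -> R) :
  (forall x, 0 < x -> is_derive x 1 f (df x)) -> (forall x, 0 < x -> 0 < df x) ->
  f x @[x --> 0^'+] --> 0 -> forall x, 0 < x -> 0 < f x.
Proof.
move=> fdf df0 f0.
have finc x y : 0 < x -> x < y -> f x < f y.
  move=> x0 xy; rewrite -subr_gt0.
  have [||c] := @MVT _ f df x y xy.
  - by move=> z; rewrite in_itv/= => /andP[xz _]; apply: fdf; exact: lt_trans xz.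
  - apply: continuous_in_subspaceT => z; rewrite inE/= in_itv/= => /andP[xz _].
    by apply: is_derive1_continuous (fdf _ _); exact: lt_le_trans xz.
  rewrite in_itv/= => /andP[xc _] ->.
  by rewrite mulr_gt0 ?subr_gt0// df0// (lt_trans x0).
(* The limit at [0^'+] yields only [0 <= f (x / 2)]; the strict increase from [x / 2] to [x]
   restores strictness. *)
move=> x x0; apply: (@le_lt_trans _ _ (f (x / 2))); last first.
  by apply: finc; lra.
apply: (cvgr_to_le f0); near=> y.
have y0 : 0 < y by [].
by apply/ltW/finc => //; near: y; apply: nbhs_right_lt; lra.
Unshelve. all: by end_near. Qed.

End derivation.

(** Recursion on the syntax of the body, constants first. What remains are the side conditions of
    inverse and logarithm, and atoms such as [varphi] whose derivative is supplied by hand. *)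
Ltac derive1 := lazymatch goal with
| |- is_derive _ _ (fun _ => ?c) _ => exact: is_derive1_cst
| |- is_derive _ _ (fun y => y) _ => exact: is_derive1_id
| |- is_derive _ _ (fun y => @?f y + @?g y) _ =>
    notypeclasses refine (@is_derive1D _ f g _ _ _ _ _); [derive1 | derive1]
| |- is_derive _ _ (fun y => - @?f y) _ =>
    notypeclasses refine (@is_derive1N _ f _ _ _); derive1
| |- is_derive _ _ (fun y => @?f y * @?g y) _ =>
    notypeclasses refine (@is_derive1M _ f g _ _ _ _ _); [derive1 | derive1]
| |- is_derive _ _ (fun y => @?f y ^+ ?n) _ =>
    notypeclasses refine (@is_derive1X _ f n _ _ _); derive1
| |- is_derive _ _ (fun y => (@?f y)^-1) _ =>
    notypeclasses refine (@is_derive1V _ f _ _ _ _); [cbv beta | derive1]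
| |- is_derive _ _ (fun y => expR (@?f y)) _ =>
    notypeclasses refine (@is_derive1_expR_comp _ f _ _ _); derive1
| |- is_derive _ _ (fun y => ln (@?f y)) _ =>
    notypeclasses refine (@is_derive1_ln_comp _ f _ _ _ _); [cbv beta | derive1]
| |- _ => idtac
end.

Ltac derive1_eq := notypeclasses refine (is_derive1_eq _ _ _ _ _ _); [derive1 | ].

(** * The Riccati equation and the positivity of [varphi] *)

Section varphi.
Context {R : realType}.
Implicit Types t : R.

Lemma expR_sub1_gt t : t != 0 -> t < expR t - 1.
Proof. by move=> t0; rewrite ltrBrDl expR_gt1Dx. Qed.

Lemma expR_sub1_gt0 t : 0 < t -> 0 < expR t - 1.
Proof. by move=> t0; rewrite subr_gt0 expR_gt1. Qed.

Lemma varphi_lt t : 0 < t -> t * varphi t < 2^-1.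
Proof.
move=> t0; rewrite /varphi mulrA divff ?gt_eqF// mul1r.
suff : (expR t - 1)^-1 < t^-1 by lra.
by rewrite ltf_pV2 ?posrE ?expR_sub1_gt0// expR_sub1_gt// gt_eqF.
Qed.

(** [(exp t - 1)^-1 + 1 = (1 - exp (-t))^-1], and [1 - exp (-t) < t]. *)
Lemma varphi_gtN t : 0 < t -> - 2^-1 < t * varphi t.
Proof.
move=> t0; rewrite /varphi mulrA divff ?gt_eqF// mul1r.
have /(expR_sub1_gt (- t)) : - t != 0 by rewrite oppr_eq0 gt_eqF.
have := expR_sub1_gt0 _ t0; rewrite expRN.
set a := expR t => a1 ta.
suff : t^-1 < (a - 1)^-1 + 1 by lra.
have -> : (a - 1)^-1 + 1 = (1 - a^-1)^-1.
  by field; apply/andP; split; apply/lt0r_neq0; lra.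
rewrite ltf_pV2 ?posrE//; first by lra.
by rewrite subr_gt0 invf_lt1//; lra.
Qed.

(* The Riccati equation of [t |-> t * varphi t + t^-1 = coth (t / 2) / 2]. *)
Lemma is_derive_varphi t : 0 < t ->
  is_derive t 1 (@varphi R) ((4^-1 - t ^+ 2 * varphi t ^+ 2 - 3 * varphi t) / t).
Proof.
move=> t0; have e0 := expR_sub1_gt0 _ t0.
rewrite [X in is_derive _ _ X _](_ : _ =
  fun t : R => t^-1 * ((expR t - 1)^-1 - t^-1 + 2^-1))//.
apply: is_derive_eq; first by derive1; rewrite ?gt_eqF.
by rewrite /varphi; field; rewrite ?gt_eqF.
Qed.

(** [t ^+ 3] is the integrating factor that removes the linear term [- 3 * varphi t / t] of the
    Riccati equation. *)
Lemma is_derive_exprn_varphi t : 0 < t ->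
  is_derive t 1 (fun t => t ^+ 3 * varphi t)
    (t ^+ 2 * (4^-1 - t ^+ 2 * varphi t ^+ 2)).
Proof.
move=> t0; apply: is_derive_eq.
  by derive1; exact: is_derive_varphi.
by rewrite /=; field; rewrite gt_eqF.
Qed.

Lemma cvg_exprn_varphi : t ^+ 3 * varphi t @[t --> (0 : R)^'+] --> (0 : R).
Proof.
apply/norm_cvg0P.
apply: (@squeeze_cvgr _ _ _ _ (fun=> 0) (fun t => t ^+ 2)).
- near=> t; have t0 : 0 < t by [].
  rewrite normr_ge0/= (_ : t ^+ 3 * _ = t ^+ 2 * (t * varphi t)); last by ring.
  rewrite normrM ger0_norm ?exprn_ge0 ?ler_piMr ?exprn_ge0 ?ltW// ltr_norml.
  by have := varphi_lt _ t0; have := varphi_gtN _ t0; lra.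
- exact: cvg_cst.
- have : t ^+ 2 @[t --> (0 : R)] --> (0 : R) ^+ 2 by exact: exprn_continuous.
  by rewrite expr0n; exact: cvg_at_right_filter.
Unshelve. all: by end_near. Qed.

(** The two bounds on [t * varphi t] say [t^2 varphi^2 < 1/4], so [t^3 varphi] has a positive
    derivative; it tends to 0 at [0^'+]. *)
Lemma varphi_gt0 t : 0 < t -> 0 < varphi t.
Proof.
move=> t0; rewrite -(@pmulr_rgt0 _ (t ^+ 3)) ?exprn_gt0//.
move: t t0; apply: (is_derive1_gt0_gt0 _ _ is_derive_exprn_varphi) => [t t0|].
  rewrite mulr_gt0 ?exprn_gt0// subr_gt0 -exprMn.
  by have := varphi_lt _ t0; have := varphi_gtN _ t0; nra.
exact: cvg_exprn_varphi.
Qed.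

End varphi.

(** * Expansion of [varphi] with positive remainders *)

(** Each [r (n - j)] is expanded once, and [r 0 * r n] twice: first in [r n], then in the [r 0]
    multiplying [c n]. The latter supplies the terms [j = n] of both sums on the right. *)
Lemma remainder_convolution (K : comRingType) (c r : nat -> K) (x : K) :
  (forall n, r n = c n - x * r n.+1) -> forall n,
  \sum_(j < n) c j * r (n - j)%N + r 0%N * r n =
  \sum_(j < n.+1) c j * c (n - j)%N -
  x * (\sum_(j < n.+1) c j * r (n.+1 - j)%N + r 0%N * r n.+1).
Proof.
move=> rS n.
rewrite [X in _ = X - _]big_ord_recr [X in _ = _ - _ * (X + _)]big_ord_recr /=.
rewrite subnn subSnn.
rewrite (eq_bigr (fun j : 'I_n => c j * c (n - j)%N -
  x * (c j * r (n.+1 - j)%N))); last first.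
  by move=> j _; rewrite subSn 1?ltnW// [in LHS](rS (n - j)%N); ring.
rewrite sumrB -mulr_sumr [X in r 0%N * X]rS [in LHS](rS 0%N).
by move: (\sum_(i < n) _) (\sum_(i < n) _) => s1 s2; rewrite [in RHS](rS 0%N); ring.
Qed.

Section varphi_expansion.
Context {R : realType}.
Implicit Types t : R.

(** The recurrence uses all earlier values, so the list of them is carried to keep the recursion
    structural. The start [12^-1] comes from the Riccati equation at [t = 0], which reads
    [3 c 0 = 1/4]. *)
Fixpoint varphi_coefs (n : nat) : seq R :=
  if n is m.+1 then
    rcons (varphi_coefs m)
      ((\sum_(i < m.+1) (varphi_coefs m)`_i * (varphi_coefs m)`_(m - i)) /
       (2 * m + 5)%:R)
  else [:: 12^-1].

Definition varphi_coef n : R := (varphi_coefs n)`_n.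

Lemma size_varphi_coefs n : size (varphi_coefs n) = n.+1.
Proof. by elim: n => //= n IH; rewrite size_rcons IH. Qed.

Lemma nth_varphi_coefs n i : (i <= n)%N -> (varphi_coefs n)`_i = varphi_coef i.
Proof.
elim: n => [|n IH]; first by case: i.
rewrite leq_eqVlt => /predU1P[->//|]; rewrite ltnS => lein.
by rewrite /= nth_rcons size_varphi_coefs ltnS lein IH.
Qed.

Lemma varphi_coefS n : (2 * n + 5)%:R * varphi_coef n.+1 =
  \sum_(i < n.+1) varphi_coef i * varphi_coef (n - i).
Proof.
rewrite {1}/varphi_coef /= nth_rcons size_varphi_coefs ltnn eqxx mulrC divfK.
  apply: eq_bigr => i _; rewrite !nth_varphi_coefs ?leq_subr//.
  by rewrite -ltnS.
by rewrite pnatr_eq0; lia.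
Qed.

Lemma varphi_coef_gt0 n : 0 < varphi_coef n.
Proof.
elim/ltn_ind: n => -[|n] IH; first by rewrite /varphi_coef/=; lra.
rewrite -(@pmulr_rgt0 _ (2 * n + 5)%:R) ?ltr0n; last by lia.
rewrite varphi_coefS big_ord_recl ltr_pwDl ?mulr_gt0 ?IH//; first by lia.
by rewrite sumr_ge0// => i _; rewrite mulr_ge0 ?ltW ?IH//; lia.
Qed.

(* The remainder in [varphi t = \sum_(i < n) (-1)^i varphi_coef i t^(2i) +
   (-1)^n t^(2n) varphi_rem n t], which is meant for [t > 0] only. *)
Fixpoint varphi_rem (n : nat) t : R :=
  if n is m.+1 then (varphi_coef m - varphi_rem m t) / t ^+ 2 else varphi t.

Lemma varphi_remS n t : 0 < t ->
  varphi_rem n t = varphi_coef n - t ^+ 2 * varphi_rem n.+1 t.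
Proof. by move=> t0 /=; field; rewrite gt_eqF. Qed.

Lemma varphi_expansion n t : 0 < t -> varphi t =
  \sum_(i < n) (-1) ^+ i * varphi_coef i * t ^+ (2 * i) +
  (-1) ^+ n * t ^+ (2 * n) * varphi_rem n t.
Proof.
move=> t0; elim: n => [|n IH]; first by rewrite big_ord0 muln0 !expr0 !mul1r add0r.
rewrite big_ord_recr [LHS]IH [in LHS](varphi_remS _ _ t0) -addrA; congr (_ + _).
by rewrite mulnS exprD (exprS (-1)); move: (varphi_rem n.+1 t) (_ ^+ n) => r e /=; ring.
Qed.

(** The [n]-th remainder of [varphi t ^+ 2] expanded in powers of [- t ^+ 2], written so that only
    remainders of index at most [n] occur, all with a plus sign. *)
Definition varphi_quad n t : R :=
  \sum_(j < n) varphi_coef j * varphi_rem (n - j) t + varphi t * varphi_rem n t.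

Lemma varphi_quadS n t : 0 < t ->
  varphi_quad n t =
  (2 * n + 5)%:R * varphi_coef n.+1 - t ^+ 2 * varphi_quad n.+1 t.
Proof.
move=> t0; rewrite varphi_coefS /varphi_quad -[varphi t]/(varphi_rem 0 t).
exact: (@remainder_convolution _ _ (varphi_rem ^~ t) _ (fun m => varphi_remS m t t0)).
Qed.

(** For [n = 0] this is the Riccati equation. In the inductive step the factor [t ^- 2] raises
    [2 n + 5] by 2, and [varphi_quadS] supplies the constant [(2 n + 5) c (n+1)] that joins
    [r (n+1)] to form [t^2 r (n+2)]. *)
Lemma is_derive_varphi_rem n t : 0 < t ->
  is_derive t 1 (varphi_rem n.+1)
    ((varphi_quad n t - (2 * n + 5)%:R * varphi_rem n.+1 t) / t).
Proof.
move=> t0; elim: n => [|n IH].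
- rewrite /varphi_quad big_ord0 /= /varphi_coef/=.
  derive1_eq; [exact: is_derive_varphi|by rewrite expf_neq0// gt_eqF|].
  by rewrite /=; field; rewrite gt_eqF.
- have E := varphi_quadS n _ t0.
  have E' := varphi_remS n.+1 _ t0.
  change (varphi_rem n.+2) with
    (fun t => (varphi_coef n.+1 - varphi_rem n.+1 t) / t ^+ 2) at 1.
  derive1_eq; [exact: IH|by rewrite expf_neq0// gt_eqF|].
  rewrite (_ : (2 * n.+1 + 5)%:R = (2 * n + 5)%:R + 2 :> R); last first.
    by rewrite -natrD; congr _%:R; lia.
  move: E E'.
  generalize (varphi_rem n.+2 t) (varphi_rem n.+1 t) => r2 r1.
  generalize (varphi_quad n t) (varphi_quad n.+1 t) => q q1.
  move=> -> ->; move: (_%:R : R) => k.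
  by rewrite /=; field; rewrite gt_eqF.
Qed.

(** [t^(2n+5) r (n+1) = c n t^(2n+3) - t^(2n+3) r n], where both terms vanish in the limit. *)
Lemma cvg_exprn_varphi_rem n :
  t ^+ (2 * n + 3) * varphi_rem n t @[t --> (0 : R)^'+] --> (0 : R).
Proof.
elim: n => [|n IH]; first exact: cvg_exprn_varphi.
have : varphi_coef n * t ^+ (2 * n + 3) - t ^+ (2 * n + 3) * varphi_rem n t
    @[t --> (0 : R)^'+] --> varphi_coef n * 0 ^+ (2 * n + 3) - 0.
  apply: cvgB => //; apply: cvgMr; apply: cvg_at_right_filter.
  exact: exprn_continuous.
rewrite addn3 expr0n mulr0 subr0; apply: cvg_trans.
apply: near_eq_cvg; near=> t; have t0 : 0 < t by [].
rewrite (_ : (2 * n.+1 + 3 = (2 * n).+3 + 2)%N); last by lia.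
by rewrite exprD /=; field; rewrite gt_eqF.
Unshelve. all: by end_near. Qed.

(** The integrating factor [t^(2n+5)] leaves the derivative [t^(2n+4) varphi_quad n t], which is
    positive by strong induction. *)
Lemma varphi_rem_gt0 n t : 0 < t -> 0 < varphi_rem n t.
Proof.
elim/ltn_ind: n t => -[|n] IH t t0; first exact: varphi_gt0.
rewrite -(@pmulr_rgt0 _ (t ^+ (2 * n.+1 + 3))) ?exprn_gt0//.
move: t t0; apply: (is_derive1_gt0_gt0 _
  (fun t => t ^+ (2 * n + 4) * varphi_quad n t)).
- move=> t t0; derive1_eq; first exact: is_derive_varphi_rem.
  rewrite (_ : (2 * n.+1 + 3 = (2 * n + 4).+1)%N); last by lia.
  rewrite (_ : (2 * n + 4).+1%:R = (2 * n + 5)%:R); last by congr _%:R; lia.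
  move: (varphi_rem n.+1 t) => r.
  by rewrite exprS /=; field; rewrite gt_eqF.
- move=> t t0; rewrite mulr_gt0 ?exprn_gt0// /varphi_quad ltr_wpDl//.
    rewrite sumr_ge0// => j _; rewrite mulr_ge0 ?(ltW (varphi_coef_gt0 _))//.
    by apply/ltW/IH => //; lia.
  by rewrite mulr_gt0 ?varphi_gt0// IH.
- exact: cvg_exprn_varphi_rem.
Qed.

Lemma varphi_rem_le n t : 0 < t -> varphi_rem n t <= varphi_coef n.
Proof.
move=> t0; rewrite [leLHS](varphi_remS _ _ t0) gerBl mulr_ge0 ?sqr_ge0//.
exact/ltW/varphi_rem_gt0.
Qed.

End varphi_expansion.

(** * Asymptotic expansions at [0^'+] and their uniqueness *)

Section asymptotic_expansion.
Context {R : realType}.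
Implicit Types (f : R -> R) (a b : nat -> R) (z : R).

(** One-sided, because the remainders of [varphi] are controlled for positive arguments; one side
    already determines the coefficients. *)
Definition asymptotic_upto f a N :=
  exists K, \forall z \near (0 : R)^'+,
    `|f z - \sum_(k < N) a k * z ^+ k| <= K * z ^+ N.

Definition asymptotic_expansion f a := forall N, asymptotic_upto f a N.

(** Once the coefficients below [n] agree, [|a n - b n| z^n <= (K1 + K2) z^(n+1)]; divide by [z^n]
    and let [z] tend to 0. *)
Lemma asymptotic_expansion_unique f a b :
  asymptotic_expansion f a -> asymptotic_expansion f b -> forall n, a n = b n.
Proof.
move=> fa fb; elim/ltn_ind => n IH.
have [K1 h1] := fa n.+1; have [K2 h2] := fb n.+1.
apply/eqP; rewrite -subr_eq0 -normr_le0.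
have K0 : (K1 + K2) * z @[z --> (0 : R)^'+] --> (K1 + K2) * 0.
  by apply: cvgMr; apply: cvg_at_right_filter; exact: cvg_id.
rewrite mulr0 in K0; apply: (cvgr_to_ge K0); near=> z.
have z0 : 0 < z by [].
have : `|f z - \sum_(k < n.+1) a k * z ^+ k| <= K1 * z ^+ n.+1 by near: z.
have : `|f z - \sum_(k < n.+1) b k * z ^+ k| <= K2 * z ^+ n.+1 by near: z.
rewrite !big_ord_recr /= (eq_bigr (fun k : 'I_n => a k * z ^+ k)); last first.
  by move=> k _; rewrite IH.
move: (\sum_(i < n) _) => s hb ha.
rewrite -(ler_pM2r (exprn_gt0 n z0)) -mulrA -exprS.
rewrite -{1}(gtr0_norm (exprn_gt0 n z0)) -normrM [leRHS]mulrDl.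
rewrite (_ : (a n - b n) * z ^+ n =
  (f z - (s + b n * z ^+ n)) - (f z - (s + a n * z ^+ n))); last by ring.
by rewrite (le_trans (ler_normB _ _))// addrC lerD.
Unshelve. all: by end_near. Qed.

Lemma asymptotic_upto_weaken f a N m :
  asymptotic_upto f a (N + m) -> asymptotic_upto f a N.
Proof.
elim: m => [|m IH]; first by rewrite addn0.
rewrite addnS => -[K h]; apply: IH; move: h; move: (N + m)%N => {}N h.
exists (`|K| + `|a N|); near=> z.
have z0 : 0 < z by [].
have z1 : z < 1 by near: z; exact: nbhs_right_lt.
have : `|f z - \sum_(k < N.+1) a k * z ^+ k| <= K * z ^+ N.+1 by near: z.
rewrite big_ord_recr/=; move: (\sum_(i < N) _) => s hs.
rewrite (_ : f z - s = (f z - (s + a N * z ^+ N)) + a N * z ^+ N); last by ring.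
rewrite (le_trans (ler_normD _ _))// mulrDl lerD//.
  rewrite (le_trans hs)// (le_trans (ler_norm _))// normrM ler_wpM2l//.
  by rewrite gtr0_norm ?exprn_gt0// exprS ler_piMl ?exprn_ge0 ?ltW.
by rewrite normrM [X in _ * X <= _]gtr0_norm// exprn_gt0.
Unshelve. all: by end_near. Qed.

Lemma sum_exprn_le2 z n : 0 <= z -> z <= 2^-1 -> \sum_(i < n) z ^+ i <= 2.
Proof.
move=> z0 z1; have := subrX1 z n; have : 0 <= z ^+ n by rewrite exprn_ge0.
have : 0 <= \sum_(i < n) z ^+ i by rewrite sumr_ge0// => i _; rewrite exprn_ge0.
by move: (z ^+ n) (\sum_(i < n) _) => u s; nra.
Qed.

(** Convergence at one point [w > 0] bounds the terms [a k w^k] by some [C]. For [z <= w / 2] the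
    tail from [N] on is then dominated by a geometric series of ratio [z / w <= 1/2], whence the
    constant [2 C w^-N]. *)
Lemma series_asymptotic_expansion f a :
  (\forall z \near (0 : R)^',
     series (fun k => a k * z ^+ k) n @[n --> \oo] --> f z) ->
  asymptotic_expansion f a.
Proof.
move=> h N.
have {}h : \forall z \near (0 : R)^'+,
    series (fun k => a k * z ^+ k) n @[n --> \oo] --> f z.
  by move: h; apply: within_subset => r /=; exact: lt0r_neq0.
have [w [w0 hw]] : exists w : R, 0 < w /\ series (fun k => a k * w ^+ k) n @[n --> \oo] --> f w.
  near (0 : R)^'+ => w; exists w; split; first by [].
  by near: w.
have [C hC] : exists C : R, forall k, `|a k * w ^+ k| <= C.
  have /cvg_seq_bounded : cvgn (fun k => a k * w ^+ k).
    apply/cvg_ex; exists 0; apply: cvg_series_cvg_0.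
    by apply/cvg_ex; exists (f w).
  move=> /pinfty_ex_gt0[C _ hC]; exists C => k; exact: hC.
exists (C * (w ^- N * 2)); near=> z.
have z0 : 0 < z by [].
have zw : z <= w * 2^-1.
  by near: z; apply: nbhs_right_le; rewrite mulr_gt0.
have hz : series (fun k => a k * z ^+ k) n @[n --> \oo] --> f z by near: z.
have hl : `|series (fun k => a k * z ^+ k) n - \sum_(k < N) a k * z ^+ k| @[n --> \oo] -->
  `|f z - \sum_(k < N) a k * z ^+ k|.
  by apply: cvg_norm; apply: cvgB => //; exact: cvg_cst.
apply: (cvgr_to_le hl); exists N => // n /= Nn.
rewrite /series/= -(big_mkord predT (fun k => a k * z ^+ k)).
rewrite (big_cat_nat (n := N))//= addrAC subrr add0r.
rewrite -{1}(add0n N) big_addn big_mkord (le_trans (ler_norm_sum _ _ _))//.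
have C0 : 0 <= C by rewrite (le_trans _ (hC 0%N)).
apply: (@le_trans _ _ (\sum_(i < n - N) C * (z / w) ^+ N * (z / w) ^+ i)).
  apply: ler_sum => i _.
  rewrite (_ : a _ * _ = (a (i + N)%N * w ^+ (i + N)) * (z / w) ^+ (i + N)).
    rewrite normrM -mulrA -exprD addnC ler_pM//.
    by rewrite ger0_norm// exprn_ge0// divr_ge0// ltW.
  by rewrite -mulrA -exprMn mulrCA mulfV ?gt_eqF// mulr1.
rewrite -mulr_sumr [leRHS](_ : _ = C * (z / w) ^+ N * 2); last first.
  by rewrite [in RHS]expr_div_n; move: (w ^- N) (z ^+ N) => u v; ring.
rewrite ler_wpM2l//; first by rewrite mulr_ge0// exprn_ge0// divr_ge0// ltW.
apply: sum_exprn_le2; first by rewrite divr_ge0// ltW.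
by rewrite ler_pdivrMr// mulrC.
Unshelve. all: by end_near. Qed.

End asymptotic_expansion.

(** * Bernoulli numbers in terms of [varphi_coef] *)

Section bernoulli_numbers.
Context {R : realType}.

(** The values [B_k / k!], read off from [z / (exp z - 1) = 1 - z / 2 + z^2 varphi z]; the factor
    [z^2] causes the shift of index by 2. *)
Definition bernoulli_egf_coef (k : nat) : R :=
  match k with
  | 0 => 1
  | 1 => - 2^-1
  | j.+2 => if odd j then 0 else (-1) ^+ j./2 * varphi_coef j./2
  end.

Lemma bernoulli_egf_expansion :
  asymptotic_expansion (fun z : R => z / (expR z - 1)) bernoulli_egf_coef.
Proof.
(* Stopping [varphi] after [N] terms leaves an error of order [2 N + 2], more than the required
   order [N]. *)
move=> N; apply: (@asymptotic_upto_weaken _ _ _ _ (N + 2)).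
have -> : (N + (N + 2) = 2 * N + 2)%N by lia.
exists (varphi_coef N); near=> z; have z0 : 0 < z by [].
have zE : z / (expR z - 1) = 1 - 2^-1 * z + z ^+ 2 * varphi z.
  by rewrite /varphi; field; rewrite !gt_eqF ?expR_sub1_gt0.
have -> : \sum_(k < 2 * N + 2) bernoulli_egf_coef k * z ^+ k =
    1 - 2^-1 * z +
    z ^+ 2 * \sum_(i < N) (-1) ^+ i * varphi_coef i * z ^+ (2 * i).
  elim: N => [|n IH].
    by rewrite muln0 add0n 2!big_ord_recr !big_ord0 /=; ring.
  rewrite (_ : 2 * n.+1 + 2 = (2 * n + 2).+2)%N; last by lia.
  rewrite 2!big_ord_recr [in RHS]big_ord_recr /= IH.
  rewrite addn2 /= mul2n odd_double doubleK mul0r addr0 -mul2n.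
  rewrite !(exprS z).
  by move: (varphi_coef n) (_ ^+ n) => c e; ring.
rewrite zE (varphi_expansion N _ z0); have r0 := varphi_rem_gt0 N z z0.
have rc := varphi_rem_le N z z0.
move: (varphi_rem N z) (\sum_(i < N) _) r0 rc => r s r0 rc.
rewrite (_ : _ - _ = (-1) ^+ N * (r * z ^+ (2 * N + 2))); last first.
  by rewrite exprD; move: (_ ^+ N) => e; ring.
rewrite normrM normrX normrN1 expr1n mul1r gtr0_norm ?mulr_gt0 ?exprn_gt0//.
by rewrite ler_wpM2r// exprn_ge0// ltW.
Unshelve. all: by end_near. Qed.

(** At [t = 0] the generating function is [z / (exp z - 1)], so both sequences of coefficients
    expand the same function and uniqueness applies. *)
Lemma bernoulli_numberE (B : nat -> {poly R}) : bernoulli_polynomials B ->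
  forall k, bernoulli_number B k = k`!%:R * bernoulli_egf_coef k.
Proof.
move=> hB k; rewrite mulrC; apply: (canRL (divfK _)).
  by rewrite pnatr_eq0 -lt0n fact_gt0.
move: k; apply: asymptotic_expansion_unique bernoulli_egf_expansion.
apply: series_asymptotic_expansion; near=> z.
have : series (fun k => (B k).[0] * (z ^+ k / k`!%:R)) @ \oo -->
    z * expR (0 * z) / (expR z - 1) by near: z; exact: hB.
rewrite mul0r expR0 mulr1; apply: cvg_trans; apply: near_eq_cvg.
near=> n; apply: eq_bigr => k _.
by rewrite /bernoulli_number mulrAC mulrA.
Unshelve. all: by end_near. Qed.

Lemma bernoulli_number_odd (B : nat -> {poly R}) j : bernoulli_polynomials B ->
  bernoulli_number B (2 * j + 3) = 0.
Proof.
move=> /bernoulli_numberE ->.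
by rewrite addn3 /= mul2n odd_double mulr0.
Qed.

Lemma bernoulli_number_even (B : nat -> {poly R}) j : bernoulli_polynomials B ->
  bernoulli_number B (2 * j + 2) =
    (2 * j + 2)`!%:R * ((-1) ^+ j * varphi_coef j).
Proof.
move=> /bernoulli_numberE ->.
by rewrite addn2 /= mul2n odd_double doubleK.
Qed.

End bernoulli_numbers.

(** * Integrals over the positive half-line *)

Section half_line_integral.
Context {R : realType}.
Implicit Types (f g : R -> R) (x t : R).
Let mu := @lebesgue_measure R.

Lemma continuous_measurable_half_line f :
  (forall t, 0 < t -> {for t, continuous f}) ->
  measurable_fun (`]0%R, +oo[ : set R) (EFin \o f).
Proof.
move=> cf; apply/measurable_EFinP; apply: open_continuous_measurable_fun => //.
by move=> t; rewrite inE/= in_itv/= andbT; exact: cf.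
Qed.

(** A zero integral would make [f] vanish almost everywhere, putting the half-line, of infinite
    measure, inside a null set. *)
Lemma integral_half_line_gt0 f :
  (forall t, 0 < t -> {for t, continuous f}) -> (forall t, 0 < t -> 0 < f t) ->
  (0 < \int[mu]_(t in `]0%R, +oo[) (f t)%:E)%E.
Proof.
move=> cf f0; have mf := continuous_measurable_half_line _ cf.
have pos t : `]0%R, +oo[%classic t -> 0 < f t by rewrite /= in_itv/= andbT; exact: f0.
rewrite lt0e integral_ge0 ?andbT; last by move=> t /pos/ltW; rewrite lee_fin.
apply/eqP => I0.
have : (\int[mu]_(t in `]0%R, +oo[) `|(f t)%:E| = 0)%E.
  rewrite -{}[RHS]I0; apply: eq_integral => t /set_mem/pos tp.
  by rewrite gee0_abs// lee_fin ltW.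
move=> /(ae_eq_integral_abs mu (measurable_itv _) mf)[N [mN N0 sub]].
have : (mu `]0%R, +oo[%classic <= mu N)%E.
  apply: le_measure; rewrite ?inE// => t tp; apply: sub => /= /(_ tp) [] ft0.
  by have := pos _ tp; rewrite ft0 ltxx.
rewrite (_ : mu N = 0%E); last exact: N0.
by rewrite /mu lebesgue_measure_itv/= ltry.
Qed.

(** [exp (x t) >= (x t)^(m+1) / (m+1)!] bounds the expression by a multiple of [t^-1]. *)
Lemma cvg_exprn_expRN x m : 0 < x ->
  t ^+ m * expR (- (x * t)) @[t --> +oo%R] --> (0 : R).
Proof.
move=> x0.
have K0 : m.+1`!%:R / x ^+ m.+1 * t^-1 @[t --> +oo%R] --> (0 : R).
  rewrite -[X in _ --> X](mulr0 (m.+1`!%:R / x ^+ m.+1)).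
  apply: cvgMr; apply/gtr0_cvgV0; last exact: cvg_id.
  by exists 0; split.
apply: (squeeze_cvgr _ (cvg_cst 0) K0); near=> t.
have t0 : 0 < t by near: t; apply: nbhs_pinfty_gt.
have f0 : 0 < m.+1`!%:R :> R by rewrite ltr0n fact_gt0.
rewrite /= mulr_ge0 ?exprn_ge0 ?expR_ge0 ?(ltW t0)//= expRN.
rewrite ler_pdivrMr ?expR_gt0//.
have := @expR_ge1Dxn R (x * t) m (ltW (mulr_gt0 x0 t0)).
rewrite exprMn => h.
have K : 0 < m.+1`!%:R / x ^+ m.+1 * t^-1.
  by rewrite !mulr_gt0 ?invr_gt0 ?exprn_gt0.
apply: (@le_trans _ _ (m.+1`!%:R / x ^+ m.+1 * t^-1 *
    (x ^+ m.+1 * t ^+ m.+1 / m.+1`!%:R))); last first.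
  by rewrite ler_pM2l//; apply: le_trans h; rewrite lerDr.
have xm : x ^+ m.+1 != 0 by rewrite expf_neq0// gt_eqF.
by move: (x ^+ m.+1) xm => u u0; rewrite exprS le_eqVlt; apply/orP; left; apply/eqP;
  field; rewrite u0 !gt_eqF.
Unshelve. all: by end_near. Qed.

(** Integration by parts, normalised to vanish at infinity, so that the integral is minus the value
    at 0. *)
Fixpoint exprn_expR_primitive x m t : R :=
  if m is p.+1 then
    (p.+1%:R * exprn_expR_primitive x p t - t ^+ p.+1 * expR (- (x * t))) / x
  else - expR (- (x * t)) / x.

Lemma is_derive_exprn_expR_primitive x m t : 0 < x ->
  is_derive t 1 (exprn_expR_primitive x m) (t ^+ m * expR (- (x * t))).
Proof.
move=> x0; elim: m => [|m IH] /=.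
  by derive1_eq; rewrite /=; field; rewrite gt_eqF.
derive1_eq; first exact: IH.
by rewrite /=; field; rewrite gt_eqF.
Qed.

Lemma cvg_exprn_expR_primitive x m : 0 < x ->
  exprn_expR_primitive x m t @[t --> +oo%R] --> (0 : R).
Proof.
move=> x0; elim: m => [|m IH] /=.
  have : - (t ^+ 0 * expR (- (x * t))) / x @[t --> +oo%R] --> - 0 / x.
    by apply: cvgMl; apply: cvgN; exact: cvg_exprn_expRN.
  rewrite oppr0 mul0r; apply: cvg_trans; apply: near_eq_cvg; near=> t.
  by rewrite expr0 mul1r.
have : (m.+1%:R * exprn_expR_primitive x m t - t ^+ m.+1 * expR (- (x * t))) / x
    @[t --> +oo%R] --> (m.+1%:R * 0 - 0) / x.
  apply: cvgMl; apply: cvgB; [exact: cvgMr|exact: cvg_exprn_expRN].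
by rewrite mulr0 subr0 mul0r.
Unshelve. all: by end_near. Qed.

Lemma exprn_expR_primitive0 x m : 0 < x ->
  exprn_expR_primitive x m 0 = - (m`!%:R / x ^+ m.+1).
Proof.
move=> x0; elim: m => [|m IH] /=.
  by rewrite mulr0 oppr0 expR0 fact0 expr1 mulNr.
rewrite IH expr0n mul0r subr0 factS natrM [in RHS]exprS.
have : x ^+ m.+1 != 0 by rewrite expf_neq0// gt_eqF.
by move: (x ^+ m.+1) => u u0; field; rewrite u0 gt_eqF.
Qed.

Lemma integral_exprn_expR x m : 0 < x ->
  (\int[mu]_(t in `]0%R, +oo[) (t ^+ m * expR (- (x * t)))%:E =
   (m`!%:R / x ^+ m.+1)%:E)%E.
Proof.
move=> x0.
have df t : is_derive t 1 (exprn_expR_primitive x m) (t ^+ m * expR (- (x * t))).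
  exact: is_derive_exprn_expR_primitive.
have cf : continuous (fun t => t ^+ m * expR (- (x * t))).
  by move=> t; apply: is_derive1_continuous; derive1.
rewrite integral_itv_obnd_cbnd; last first.
  by apply: continuous_measurable_half_line => t _; exact: cf.
rewrite (@ge0_continuous_FTC2y _ _ (exprn_expR_primitive x m) _ 0).
- by rewrite exprn_expR_primitive0// sub0e -EFinN opprK.
- by move=> t t0; rewrite mulr_ge0 ?exprn_ge0// expR_ge0.
- exact: continuous_subspaceT.
- exact: cvg_exprn_expR_primitive.
- by move=> t _; case: (df t).
- by apply: cvg_at_right_filter; apply: is_derive1_continuous (df 0).
- by move=> t _; rewrite derive1E; case: (df t).
Qed.

End half_line_integral.

(** * The enveloping expansion of Binet's function *)

Section binet_expansion.
Context {R : realType}.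
Implicit Types (x t : R).

Lemma varphi_rem_continuous n t : 0 < t -> {for t, continuous (@varphi_rem R n)}.
Proof.
case: n => [|n] t0; first by apply: is_derive1_continuous; exact: is_derive_varphi.
by apply: is_derive1_continuous; exact: is_derive_varphi_rem.
Qed.

(** Up to the sign [(-1)^n], the error of the expansion of [J] after [n] terms. *)
Definition binet_rem n x : \bar R :=
  (\int[lebesgue_measure]_(t in `]0%R, +oo[)
    (t ^+ (2 * n) * varphi_rem n t * expR (- (x * t)))%:E)%E.

Let binet_rem_fun_gt0 n x t : 0 < t ->
  0 < t ^+ (2 * n) * varphi_rem n t * expR (- (x * t)).
Proof.
move=> t0; rewrite mulr_gt0 ?expR_gt0//.
by rewrite mulr_gt0 ?exprn_gt0//; exact: varphi_rem_gt0.
Qed.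

Let binet_rem_fun_continuous n x t : 0 < t ->
  {for t, continuous (fun t => t ^+ (2 * n) * varphi_rem n t * expR (- (x * t)))}.
Proof.
move=> t0; apply: cvgM; first apply: cvgM.
- exact: exprn_continuous.
- exact: varphi_rem_continuous.
- have : {for t, continuous (fun t => expR (- (x * t)))}; last by [].
  by apply: is_derive1_continuous; derive1.
Qed.

Lemma binet_rem_gt0 n x : (0 < binet_rem n x)%E.
Proof.
apply: integral_half_line_gt0 => t t0.
  exact: binet_rem_fun_continuous.
exact: binet_rem_fun_gt0.
Qed.

(** Stated as a sum because nonnegative integrals add without integrability; finiteness of each
    remainder is then deduced from that of the sum. *)
Lemma binet_remD n x : 0 < x -> (binet_rem n x + binet_rem n.+1 x)%E =
  (varphi_coef n * ((2 * n)`!%:R / x ^+ (2 * n).+1))%:E.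
Proof.
move=> x0.
have itv t : `]0%R, +oo[%classic t -> 0 < t by rewrite /= in_itv/= andbT.
rewrite EFinM -integral_exprn_expR// -ge0_integralZl_EFin//; first last.
- exact/ltW/varphi_coef_gt0.
- apply: continuous_measurable_half_line => t t0.
  by apply: is_derive1_continuous; derive1.
- by move=> t /itv t0; rewrite lee_fin mulr_ge0 ?expR_ge0// exprn_ge0 ?ltW.
rewrite /binet_rem -ge0_integralD//; first last.
- by apply: continuous_measurable_half_line => t; exact: binet_rem_fun_continuous.
- by move=> t /itv t0; rewrite lee_fin ltW//; exact: binet_rem_fun_gt0.
- by apply: continuous_measurable_half_line => t; exact: binet_rem_fun_continuous.
- by move=> t /itv t0; rewrite lee_fin ltW//; exact: binet_rem_fun_gt0.
apply: eq_integral => t /set_mem/itv t0; rewrite -EFinM -EFinD; congr EFin.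
have := varphi_remS n t t0; move: (varphi_rem n.+1 t) (varphi_rem n t) => r1 r ->.
by rewrite mulnS exprD; ring.
Qed.

Lemma binet_rem_fin_num n x : 0 < x -> binet_rem n x \is a fin_num.
Proof.
move=> x0; rewrite ge0_fin_numE ?(ltW (binet_rem_gt0 _ _))//.
apply: (@le_lt_trans _ _ (binet_rem n x + binet_rem n.+1 x)%E).
  by rewrite leeDl// ltW// binet_rem_gt0.
by rewrite binet_remD// ltry.
Qed.

Lemma binetE x : binet x = binet_rem 0 x.
Proof. by apply: eq_integral => t _; rewrite muln0 expr0 mul1r. Qed.

Lemma binet_fin_num x : 0 < x -> binet x \is a fin_num.
Proof. by rewrite binetE; exact: binet_rem_fin_num. Qed.

Lemma binet_expansion n x : 0 < x -> fine (binet x) =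
  \sum_(j < n) (-1) ^+ j * (varphi_coef j * ((2 * j)`!%:R / x ^+ (2 * j).+1)) +
  (-1) ^+ n * fine (binet_rem n x).
Proof.
move=> x0; elim: n => [|n IH]; first by rewrite big_ord0 mul1r add0r binetE.
rewrite big_ord_recr /= IH -addrA; congr (_ + _).
have := congr1 fine (binet_remD n x x0).
rewrite fineD ?binet_rem_fin_num//= => <-.
by rewrite (exprS (-1)); move: (_ ^+ n) => e; ring.
Qed.

Lemma binet_gt0 x : 0 < x -> 0 < fine (binet x).
Proof. by move=> x0; rewrite fine_gt0// binetE binet_rem_gt0/= ltey_eq binet_rem_fin_num. Qed.

Lemma binet_le x : 0 < x -> fine (binet x) <= (12 * x)^-1.
Proof.
move=> x0; rewrite (binet_expansion 1 _ x0) big_ord1 /= !expr0 expr1 !mul1r.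
rewrite (_ : varphi_coef 0 * _ = (12 * x)^-1); last first.
  by rewrite /varphi_coef/=; field; rewrite gt_eqF.
by rewrite mulN1r lerBlDr lerDl fine_ge0// ltW// binet_rem_gt0.
Qed.

End binet_expansion.

(** * Tonelli's theorem on a rectangle *)

Section tonelli_sets.
Context {d1 d2 : measure_display} {T1 : measurableType d1} {T2 : measurableType d2}.
Context {R : realType}.
Context (m1 : {sigma_finite_measure set T1 -> \bar R}).
Context (m2 : {sigma_finite_measure set T2 -> \bar R}).

(** Extension by zero reduces this to the whole product. Nonnegativity is asked on the rectangle
    alone, since the kernel used below changes sign outside it. *)
Lemma tonelli_setX (A : set T1) (B : set T2) (g : T1 * T2 -> \bar R) :
  measurable A -> measurable B -> measurable_fun setT g ->
  (forall z, (A `*` B) z -> 0 <= g z)%E ->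
  (\int[m1]_(x in A) \int[m2]_(y in B) g (x, y) =
   \int[m2]_(y in B) \int[m1]_(x in A) g (x, y))%E.
Proof.
move=> mA mB mg g0.
have mF : measurable_fun setT (g \_ (A `*` B)).
  apply/(measurable_restrictT _ _).1; first exact: measurableX.
  exact: measurable_funTS.
have F0 z : (0 <= (g \_ (A `*` B)) z)%E by apply: erestrict_ge0.
transitivity (\int[m1]_x \int[m2]_y (g \_ (A `*` B)) (x, y))%E.
  rewrite integral_mkcond; apply: eq_integral => x _; rewrite patchE.
  case: ifPn => [/set_mem|/negP] xA.
    rewrite integral_mkcond; apply: eq_integral => y _; rewrite !patchE.
    by congr (if _ then _ else _); apply/idP/idP => /set_mem h; apply/mem_set => //; case: h.
  rewrite integral0_eq// => y _; rewrite patchE ifF//.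
  by apply/negP => /set_mem[/= ? _]; apply: xA; exact: mem_set.
rewrite fubini_tonelli//.
rewrite [RHS]integral_mkcond; apply: eq_integral => y _; rewrite [RHS]patchE.
case: ifPn => [/set_mem|/negP] yB.
  rewrite [RHS]integral_mkcond; apply: eq_integral => x _; rewrite !patchE.
  by congr (if _ then _ else _); apply/idP/idP => /set_mem h; apply/mem_set => //; case: h.
rewrite integral0_eq// => x _; rewrite patchE ifF//.
by apply/negP => /set_mem[/= _ ?]; apply: yB; exact: mem_set.
Qed.

End tonelli_sets.

(** * The difference equation of Binet's function *)

Section binet_difference.
Context {R : realType}.
Implicit Types (x t u : R).
Let mu := @lebesgue_measure R.

Lemma FTC2_derive (f F : R -> R) (a b : R) : a < b ->
  (forall x, x \in `[a, b] -> {for x, continuous f}) ->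
  (forall x, x \in `[a, b] -> is_derive x 1 F (f x)) ->
  (\int[mu]_(x in `[a, b]) (f x)%:E = (F b - F a)%:E)%E.
Proof.
move=> ab cf dF.
have cF x : x \in `[a, b] -> {for x, continuous F}.
  by move=> /dF; exact: is_derive1_continuous.
rewrite (@continuous_FTC2 _ f F)//.
- by apply: continuous_in_subspaceT => x; rewrite inE; exact: cf.
- split.
  + by move=> x /subset_itv_oo_cc/dF[].
  + by apply: cvg_at_right_filter; apply: cF; rewrite bound_itvE ltW.
  + by apply: cvg_at_left_filter; apply: cF; rewrite bound_itvE ltW.
- by move=> x /subset_itv_oo_cc/dF[? <-]; rewrite derive1E.
Qed.

Lemma integral_varphi_kernel t : 0 < t ->
  (\int[mu]_(u in `[0%R, 1%R]) (u * (1 - u) / 2 * (t * expR (- (u * t))))%:E =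
   (varphi t * (1 - expR (- t)))%:E)%E.
Proof.
move=> t0.
(* With [p = u (1 - u) / 2], repeated integration by parts gives the primitive
   [- exp (-u t) (p + p' / t + p'' / t^2)]. *)
pose F u := - (expR (- (u * t)) *
  (u * (1 - u) / 2 + (1 - 2 * u) / (2 * t) - t^-1 ^+ 2)).
transitivity (F 1 - F 0)%:E.
  apply: FTC2_derive => // u _.
    by apply: is_derive1_continuous; derive1.
  by rewrite /F; derive1_eq; rewrite /=; field; rewrite gt_eqF.
congr EFin; rewrite /F /= !mul0r !mul1r oppr0 expR0 /varphi expRN.
have := expR_sub1_gt0 _ t0; have := expR_gt0 t.
move: (expR t) => e e0 e1.
by field; rewrite !gt_eqF.
Qed.

Lemma integral_binet_diff x : 0 < x ->
  (\int[mu]_(u in `[0%R, 1%R]) (u * (1 - u) / 2 / (x + u) ^+ 2)%:E =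
   ((x + 2^-1) * ln ((x + 1) / x) - 1)%:E)%E.
Proof.
move=> x0.
have xu u : u \in `[0, 1] -> 0 < x + u.
  by rewrite in_itv/= => /andP[u0 _]; rewrite ltr_pwDl.
(* Termwise primitive of the integrand after partial fractions in powers of [x + u]. *)
pose F u := - u / 2 + (x + 2^-1) * ln (x + u) + x * (1 + x) / (2 * (x + u)).
transitivity (F 1 - F 0)%:E.
  apply: (FTC2_derive (fun u => u * (1 - u) / 2 / (x + u) ^+ 2) F 0 1 ltr01) =>
    u /xu xu0.
    apply: is_derive1_continuous; derive1.
    by rewrite expf_neq0// gt_eqF.
  rewrite /F; derive1_eq => //.
    by rewrite gt_eqF// mulr_gt0.
  by rewrite /=; field; rewrite gt_eqF.
congr EFin; rewrite /F addr0 ln_div ?posrE ?addr_gt0//.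
by move: (ln (x + 1)) (ln x) => l1 l; field; rewrite !gt_eqF ?addr_gt0.
Qed.

Lemma binet_diff x : 0 < x ->
  fine (binet x) - fine (binet (x + 1)) = (x + 2^-1) * ln ((x + 1) / x) - 1.
Proof.
move=> x0; have x10 : 0 < x + 1 by rewrite addr_gt0.
have itv t : `]0%R, +oo[%classic t -> 0 < t by rewrite /= in_itv/= andbT.
have itv1 u : `[0%R, 1%R]%classic u -> 0 <= u /\ 0 <= 1 - u.
  by rewrite /= in_itv/= => /andP[]; rewrite subr_ge0.
have cphi t : 0 < t -> {for t, continuous (@varphi R)}.
  by move=> t0; apply: is_derive1_continuous; exact: is_derive_varphi.
have cexp y t : {for t, continuous (fun t => expR (- (y * t)))}.
  by apply: is_derive1_continuous; derive1.
have phi_e t : 0 < t -> 0 < varphi t * (1 - expR (- t)).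
  by move=> t0; rewrite mulr_gt0 ?varphi_gt0// subr_gt0 expR_lt1 oppr_lt0.
have cphi_e t : 0 < t ->
    {for t, continuous (fun t => varphi t * (1 - expR (- t)) * expR (- (x * t)))}.
  move=> t0; apply: cvgM; last exact: cexp.
  apply: cvgM; first exact: cphi.
  have : {for t, continuous (fun t : R => 1 - expR (- t))}; last by [].
  by apply: is_derive1_continuous; derive1.
(* Additive form, so that only nonnegative integrals are combined in the extended reals. *)
suff E : (binet x = binet (x + 1) + ((x + 2^-1) * ln ((x + 1) / x) - 1)%:E)%E.
  by rewrite E fineD ?binet_fin_num//= addrC addKr.
rewrite -integral_binet_diff//.
transitivity (binet (x + 1) + \int[mu]_(t in `]0%R, +oo[)
    (varphi t * (1 - expR (- t)) * expR (- (x * t)))%:E)%E.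
  rewrite /binet -ge0_integralD//; first last.
  - exact: continuous_measurable_half_line.
  - by move=> t /itv t0; rewrite lee_fin mulr_ge0 ?expR_ge0// ltW ?phi_e.
  - apply: continuous_measurable_half_line => t t0.
    by apply: cvgM; [exact: cphi|exact: cexp].
  - by move=> t /itv t0; rewrite lee_fin mulr_ge0 ?expR_ge0// ltW ?varphi_gt0.
  apply: eq_integral => t /set_mem/itv t0; rewrite -EFinD; congr EFin.
  rewrite mulrDl mul1r opprD expRD.
  by move: (varphi t) => p; ring.
congr (_ + _)%E.
(* Integrated first in [u], this kernel gives [varphi t * (1 - exp (-t)) * exp (-x t)]; integrated
   first in [t], it gives [u (1 - u) / 2 / (x + u)^2]. *)
pose g (z : R * R) : \bar R :=
  (z.2 * (1 - z.2) / 2 * (z.1 * expR (- ((x + z.2) * z.1))))%:E.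
transitivity (\int[mu]_(t in `]0%R, +oo[) \int[mu]_(u in `[0%R, 1%R]) g (t, u))%E.
  apply: eq_integral => t /set_mem/itv t0.
  rewrite mulrC EFinM -integral_varphi_kernel// -ge0_integralZl_EFin ?expR_ge0//.
  - apply: eq_integral => u _; rewrite -EFinM /g/=; congr EFin.
    by rewrite mulrDl opprD expRD; ring.
  - move=> u /itv1[u0 u1]; rewrite lee_fin !mulr_ge0// ?expR_ge0//.
    exact: ltW.
  - apply/measurable_EFinP; apply: measurable_funTS; apply: continuous_measurable_fun => u.
    by apply: is_derive1_continuous; derive1.
rewrite (tonelli_setX mu mu)//; first last.
- move=> [t u] /= [/itv t0 /itv1[u0 u1]].
  by rewrite lee_fin !mulr_ge0// ?expR_ge0// ltW.
- apply/measurable_EFinP; apply: measurable_funM.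
    apply: measurable_funM => //; apply: measurable_funM => //.
    exact: measurable_funB.
  apply: measurable_funM => //; apply: measurableT_comp => //.
  apply: measurableT_comp => //; apply: measurable_funM => //.
  exact: measurable_funD.
apply: eq_integral => u /set_mem/itv1[u0 u1].
have xu : 0 < x + u by rewrite ltr_pwDl.
transitivity ((u * (1 - u) / 2)%:E *
    \int[mu]_(t in `]0%R, +oo[) (t ^+ 1 * expR (- ((x + u) * t)))%:E)%E.
  rewrite -ge0_integralZl_EFin//.
  - by move=> t /itv t0; rewrite lee_fin mulr_ge0 ?expR_ge0// exprn_ge0 ?ltW.
  - apply: continuous_measurable_half_line => t t0.
    by apply: is_derive1_continuous; derive1.
  - by rewrite !mulr_ge0.
by rewrite integral_exprn_expR// -EFinM mul1r.
Qed.

End binet_difference.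

(** * Wallis integrals and the central binomial coefficient *)

Section wallis.
Context {R : realType}.
Implicit Types x : R.

(** The reduction formula for powers of cosine, with constants making each primitive vanish at 0. *)
Fixpoint cosX_primitive (n : nat) x : R :=
  match n with
  | 0 => x
  | 1 => sin x
  | m.+2 => (cos x ^+ m.+1 * sin x + m.+1%:R * cosX_primitive m x) / m.+2%:R
  end.

Lemma nat_ind2 (P : nat -> Prop) : P 0 -> P 1 ->
  (forall n, P n -> P n.+2) -> forall n, P n.
Proof.
move=> P0 P1 PS n; suff [] : P n /\ P n.+1 by [].
by elim: n => [//|n [? ?]]; split => //; exact: PS.
Qed.

Lemma is_derive_cosX_primitive n x :
  is_derive x 1 (cosX_primitive n) (cos x ^+ n).
Proof.
elim/nat_ind2: n => [||n IH].
- by rewrite expr0; exact: is_derive1_id.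
- by rewrite expr1; exact: is_derive_sin.
- rewrite /=; derive1_eq; [exact: is_derive_cos|exact: is_derive_sin|exact: IH|].
  have := cos2Dsin2 x; rewrite /= !(exprS (cos x) n) !(exprS (cos x) n.+1).
  rewrite -(natr1 n.+1) (exprS (cos x) n); have := ltr0Sn R n.
  move: (cos x) (sin x) (n.+1%:R : R) (cos x ^+ n) => c s k u k0 cs.
  apply/eqP; rewrite -subr_eq0; apply/eqP.
  (* The two sides differ by a multiple of [cos^2 + sin^2 - 1]. *)
  transitivity (- k / (k + 1) * u * (c ^+ 2 + s ^+ 2 - 1)).
    by field; rewrite gt_eqF// addr_gt0.
  by rewrite cs subrr mulr0.
Qed.

(* The integral of [cos ^ n] over [[0, pi / 2]]. *)
Definition wallis n : R := cosX_primitive n (pi / 2).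

Lemma wallisSS n : wallis n.+2 = n.+1%:R / n.+2%:R * wallis n.
Proof. by rewrite /wallis /= cos_pihalf expr0n mul0r add0r mulrAC. Qed.

Lemma cosX_primitive0 n : cosX_primitive n 0 = 0.
Proof.
elim/nat_ind2: n => [||n IH] //=; first exact: sin0.
by rewrite IH sin0 !mulr0 addr0 mul0r.
Qed.

Lemma wallis_gt0 n : 0 < wallis n.
Proof.
elim/nat_ind2: n => [||n IH].
- by rewrite /wallis/= divr_gt0// pi_gt0.
- by rewrite /wallis/= sin_pihalf.
- by rewrite wallisSS mulr_gt0// divr_gt0.
Qed.

(** The mean value theorem for the difference of the two primitives, whose derivative
    [cos^n (1 - cos)] is nonnegative between 0 and [pi / 2]. *)
Lemma wallis_nonincreasing n : wallis n.+1 <= wallis n.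
Proof.
pose f (x : R) := cosX_primitive n x - cosX_primitive n.+1 x.
have df x : is_derive x 1 f (cos x ^+ n - cos x ^+ n.+1).
  rewrite /f; derive1_eq; [exact: (is_derive_cosX_primitive n)| |by []].
  exact: (is_derive_cosX_primitive n.+1).
have pi2 : 0 < pi / 2 :> R by rewrite divr_gt0// pi_gt0.
have [|c] := @MVT _ f (fun x => cos x ^+ n - cos x ^+ n.+1) 0 (pi / 2) pi2.
- by apply: continuous_subspaceT => x; apply: is_derive1_continuous (df x).
rewrite in_itv/= => /andP[c0 cpi] E.
rewrite -subr_ge0 (_ : _ - _ = f (pi / 2) - f 0).
  rewrite E subr0 mulr_ge0 ?(ltW pi2)// subr_ge0 exprS ler_piMl ?cos_le1//.
  by rewrite exprn_ge0// cos_ge0_pihalf//; apply/andP; split; lra.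
by rewrite /f !cosX_primitive0 !subr0.
Qed.

(** By the two-step recurrence the left side does not depend on [n]. *)
Lemma wallisM n : n.+1%:R * (wallis n * wallis n.+1) = pi / 2.
Proof.
elim: n => [|n IH]; first by rewrite /wallis/= sin_pihalf mulr1 mul1r.
by rewrite wallisSS -IH; field; rewrite gt_eqF.
Qed.

(** The binomial coefficient of [2 n] over [n], divided by [4^n]. *)
Definition central_binomial_ratio n : R := (2 * n)`!%:R / (4 ^+ n * n`!%:R ^+ 2).

Lemma wallis_even n : wallis (2 * n) = pi / 2 * central_binomial_ratio n.
Proof.
rewrite /central_binomial_ratio.
elim: n => [|n IH]; first by rewrite /wallis/= expr0 expr1n mulr1 divr1 mulr1.
rewrite mulnS wallisSS IH !add2n !factS !natrM !exprS expr0.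
have -> : (2 * n).+2%:R = 2 * n.+1%:R :> R by rewrite -natrM; congr _%:R; lia.
have : n`!%:R != 0 :> R by rewrite pnatr_eq0 -lt0n fact_gt0.
have : 4 ^+ n != 0 :> R by rewrite expf_neq0// pnatr_eq0.
have : n.+1%:R != 0 :> R by rewrite pnatr_eq0.
move: (n`!%:R) (4 ^+ n) (n.+1%:R) => u v w u0 v0 w0.
by field; rewrite u0 v0 w0.
Qed.

(** Monotonicity squeezes [W(2n)^2] between [W(2n) W(2n+1)] and [W(2n-1) W(2n)], both of which
    [wallisM] evaluates. *)
Lemma central_binomial_ratio_bounds n : (0 < n)%N ->
  pi * n%:R * central_binomial_ratio n ^+ 2 <= 1 /\
  1 <= pi * (n%:R + 2^-1) * central_binomial_ratio n ^+ 2.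
Proof.
move=> n0; have p0 := pi_gt0 R.
have e0 := wallis_even n.
have w0 := wallis_gt0 (2 * n).
have M := wallisM (2 * n); have D := wallis_nonincreasing (2 * n).
have M' := wallisM (2 * n).-1; have D' := wallis_nonincreasing (2 * n).-1.
have nE : (2 * n).-1.+1 = (2 * n)%N by lia.
rewrite nE in M' D'.
have kE : (2 * n)%:R = 2 * n%:R :> R by rewrite natrM.
have kE1 : (2 * n).+1%:R = 2 * n%:R + 1 :> R by rewrite -natr1 natrM.
rewrite kE in M'; rewrite kE1 in M.
have k0 : 0 < n%:R :> R by rewrite ltr0n.
rewrite e0 in M D M' D' w0.
have q0 : 0 < central_binomial_ratio n by rewrite -(@pmulr_rgt0 _ (pi / 2)) ?divr_gt0.
move: (wallis _) (wallis _) (central_binomial_ratio n) (n%:R : R) (pi : R)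
  M D M' D' w0 p0 k0 q0 {e0 kE kE1} => w1 w2 q k p M D M' D' w0 p0 k0 q0.
split.
- rewrite -(@ler_pM2l _ (p / 2)) ?divr_gt0// mulr1 -{2}M'.
  have : p / 2 * q * (p / 2 * q) <= w1 * (p / 2 * q) by rewrite ler_pM2r.
  by nra.
- rewrite -(@ler_pM2l _ (p / 2)) ?divr_gt0// mulr1 -{1}M.
  have : (p / 2 * q) * w2 <= (p / 2 * q) * (p / 2 * q) by rewrite ler_pM2l.
  by nra.
Qed.

End wallis.

(** * Stirling's formula with Binet's remainder *)

Section stirling.
Context {R : realType}.
Let J (n : nat) : R := fine (binet n%:R).

Lemma ln_fact_binet_cst (m : nat) :
  ln (m.+1`!%:R : R) - ((m.+1%:R + 2^-1) * ln m.+1%:R - m.+1%:R + J m.+1) =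
  1 - J 1%N.
Proof.
elim: m => [|m <-]; first by rewrite factS fact0 !ln1; ring.
have m0 : 0 < m.+1%:R :> R by rewrite ltr0n.
have h := binet_diff m.+1%:R m0.
have m10 : 0 < m.+2%:R :> R by rewrite ltr0n.
have f0 : 0 < m.+1`!%:R :> R by rewrite ltr0n fact_gt0.
have e : m.+2%:R = m.+1%:R + 1 :> R by rewrite natr1.
rewrite -e (ln_div m10 m0) -/(J m.+1) -/(J m.+2) in h.
rewrite (factS m.+1) (natrM R m.+2) (lnM m10 f0).
move: h; move: (ln m.+2%:R) (ln m.+1%:R) (J m.+2) (J m.+1)
  (ln m.+1`!%:R) => l2 l1 j2 j1 l.
rewrite e; move: (m.+1%:R : R) => k h; lra.
Qed.

Lemma stirling_binet n : (0 < n)%N ->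
  ln (n`!%:R : R) = (n%:R + 2^-1) * ln n%:R - n%:R + ln (2 * pi) / 2 + J n.
Proof.
pose C : R := 1 - J 1%N.
have H m : (0 < m)%N -> ln (m`!%:R : R) = (m%:R + 2^-1) * ln m%:R - m%:R + C + J m.
  case: m => [//|m] _; rewrite /C -(ln_fact_binet_cst m); ring.
suff E : ln (2 * pi) / 2 = C by rewrite E; exact: H.
suff E : `|ln (2 * pi) - 2 * C| <= 0.
  by move: E; rewrite normr_le0 subr_eq0 => /eqP ->; field.
(* It suffices to bound the distance by [1 / m] for every positive [m]. *)
apply: (cvgr_to_ge (@cvg_harmonic R)); apply: nearW => p /=.
move: p.+1 (ltn0Sn p) => {p}m m0.
have M0 : 0 < m%:R :> R by rewrite ltr0n.
have [b1 b2] := @central_binomial_ratio_bounds R m m0.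
have p0 := pi_gt0 R.
have f0 k : 0 < k`!%:R :> R by rewrite ltr0n fact_gt0.
have q0 : 0 < central_binomial_ratio m :> R.
  by rewrite /central_binomial_ratio divr_gt0// mulr_gt0 ?exprn_gt0.
(* The formula with unknown constant [C], used at [2 m] and twice at [m], leaves one [- C];
   comparison with the Wallis bounds then determines it. *)
have lq : ln (central_binomial_ratio m) =
    - C + (ln 2 - ln m%:R) / 2 + J (2 * m)%N - 2 * J m :> R.
  rewrite /central_binomial_ratio ln_div ?posrE ?mulr_gt0 ?exprn_gt0//.
  rewrite lnM ?posrE ?exprn_gt0// !lnXn ?exprn_gt0// !H ?muln_gt0//.
  have -> : 4 = 2 ^+ 2 :> R by ring.
  rewrite (lnXn 2 (ltr0n R 2)) (natrM R 2 m) (lnM (ltr0n R 2) M0).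
  rewrite -(mulr_natl (ln 2 *+ 2) m).
  move: (J m) (J (2 * m)%N) (ln m%:R) (ln 2) => j j2 l l2.
  by field.
have mh : 0 < m%:R + 2^-1 :> R by rewrite addr_gt0.
have lM u : 0 < u -> ln (pi * u * central_binomial_ratio m ^+ 2) =
    ln pi + ln u + 2 * ln (central_binomial_ratio m) :> R.
  move=> u0; rewrite (lnM (mulr_gt0 p0 u0) (exprn_gt0 2 q0)) (lnM p0 u0).
  by rewrite (lnXn 2 q0) mulr_natl.
have qq0 (u : R) : 0 < u -> 0 < pi * u * central_binomial_ratio m ^+ 2.
  by move=> u0; exact: (mulr_gt0 (mulr_gt0 p0 u0) (exprn_gt0 2 q0)).
have c1 : ln pi + ln m%:R + 2 * ln (central_binomial_ratio m) <= 0 :> R.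
  by rewrite -lM// -ln1 ler_ln// posrE ?qq0.
have c2 : 0 <= ln pi + ln (m%:R + 2^-1) + 2 * ln (central_binomial_ratio m) :> R.
  by rewrite -lM// -ln1 ler_ln// posrE ?qq0.
rewrite {}lq in c1 c2.
(* All errors are of order [1 / m]: this one is at most [1 / (2 m)], and [J m], [J (2 m)] lie
   between 0 and their first expansion terms. *)
have hl : ln (m%:R + 2^-1 : R) <= ln m%:R + (2 * m%:R)^-1.
  have -> : m%:R + 2^-1 = m%:R * (1 + (2 * m%:R)^-1) :> R by field; rewrite gt_eqF.
  rewrite lnM ?posrE ?addr_gt0 ?invr_gt0 ?mulr_gt0// lerD2l le_ln1Dx//.
  by rewrite (@lt_trans _ _ 0) ?invr_gt0 ?mulr_gt0 ?ltrN10.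
have M20 : 0 < (2 * m)%:R :> R by rewrite ltr0n muln_gt0.
have j1 : 0 < J m by exact: binet_gt0.
have j2 : J m <= (12 * m%:R)^-1 by exact: binet_le.
have j3 : 0 < J (2 * m)%N by exact: binet_gt0.
have j4 : J (2 * m)%N <= (12 * (2 * m)%:R)^-1 by exact: binet_le.
rewrite (natrM R 2 m) !invfM in j4; rewrite invfM in j2; rewrite invfM in hl.
have l2p : ln (2 * pi) = ln 2 + ln pi :> R by rewrite (lnM (ltr0n R 2) p0).
rewrite l2p; have : 0 < m%:R^-1 :> R by rewrite invr_gt0.
move: c1 c2 hl j1 j2 j3 j4.
move: (J m) (J (2 * m)%N) (ln (m%:R : R)) (ln (2 : R)) (ln (pi : R))
  (ln (m%:R + 2^-1 : R)) (m%:R^-1 : R).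
move=> a b c e g h v *; rewrite ler_norml; apply/andP; split; lra.
Qed.

End stirling.

(** * The mean absolute deviation of a Poisson variable *)

Section poisson_mean_absolute_deviation.
Context {R : realType}.
Implicit Type lambda : nat.

Lemma nneseries_EFin_cvg (u : nat -> R) (l : R) :
  \sum_(k < n) u k @[n --> \oo] --> l -> (\sum_(k <oo) (u k)%:E = l%:E)%E.
Proof.
move=> ul; apply: cvg_lim => //.
have : (\sum_(k < n) u k)%:E @[n --> \oo] --> l%:E.
  by apply: cvg_EFin; [exact: nearW|exact: ul].
apply: cvg_trans; apply: near_eq_cvg; near=> n.
by rewrite /= big_mkord sumEFin.
Unshelve. all: by end_near. Qed.

Lemma poisson_pmfE lambda k : (0 < lambda)%N ->
  poisson_pmf (lambda%:R : R) k = exp_coeff lambda%:R k * expR (- lambda%:R).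
Proof. by move=> l0; rewrite /poisson_pmf ltr0n l0. Qed.

Lemma poisson_pmf_cvg0 lambda : (0 < lambda)%N ->
  poisson_pmf (lambda%:R : R) k @[k --> \oo] --> (0 : R).
Proof.
move=> l0; rewrite -[X in _ --> X](mul0r (expR (- lambda%:R))).
under eq_fun do rewrite poisson_pmfE//.
by apply: cvgMl; exact: cvg_exp_coeff.
Qed.

Lemma poisson_pmf_sum lambda : (0 < lambda)%N ->
  (\sum_(k <oo) (poisson_pmf (lambda%:R : R) k)%:E = 1)%E.
Proof.
move=> l0; apply: nneseries_EFin_cvg.
have : series (exp_coeff (lambda%:R : R)) n * expR (- lambda%:R) @[n --> \oo] -->
    expR (lambda%:R : R) * expR (- lambda%:R).
  apply: cvgMl; exact: is_cvg_series_exp_coeff.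
rewrite -expRD subrr expR0; apply: cvg_trans; apply: near_eq_cvg; near=> n.
rewrite /series/= mulr_suml big_mkord; apply: eq_bigr => k _.
by rewrite poisson_pmfE.
Unshelve. all: by end_near. Qed.

Lemma poisson_pmfS lambda k : (0 < lambda)%N ->
  k.+1%:R * poisson_pmf (lambda%:R : R) k.+1 =
  lambda%:R * poisson_pmf (lambda%:R : R) k.
Proof.
move=> l0; rewrite !poisson_pmfE// /exp_coeff/= exprS factS natrM.
have : k`!%:R != 0 :> R by rewrite pnatr_eq0 -lt0n fact_gt0.
have : k.+1%:R != 0 :> R by rewrite pnatr_eq0.
move: (k`!%:R : R) (k.+1%:R : R) (lambda%:R : R) (expR _) (_ ^+ k).
by move=> f s l e u s0 f0; field; rewrite s0 f0.
Qed.

(** From [k p k = lambda p (k-1)] one gets [(k - lambda) p k = lambda (p (k-1) - p k)], so the sum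
    telescopes on either side of [lambda]. The two branches agree at [n = lambda]. *)
Lemma sum_poisson_deviation lambda n : (0 < lambda)%N ->
  \sum_(k < n.+1) `|k%:R - lambda%:R| * poisson_pmf (lambda%:R : R) k =
  if (n <= lambda)%N then lambda%:R * poisson_pmf lambda%:R n
  else 2 * lambda%:R * poisson_pmf lambda%:R lambda
       - lambda%:R * poisson_pmf lambda%:R n.
Proof.
move=> l0; elim: n => [|n IH].
  by rewrite big_ord1 sub0r normrN ger0_norm.
rewrite big_ord_recr /= IH; have S := poisson_pmfS lambda n l0.
case: (ltngtP n lambda) => [nl|nl|nl].
- rewrite ler0_norm ?subr_le0 ?ler_nat//.
  by rewrite opprB mulrBl S addrC subrK.
- rewrite ger0_norm; last by rewrite subr_ge0 ler_nat; lia.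
  by rewrite mulrBl S; ring.
- rewrite ger0_norm; last by rewrite subr_ge0 ler_nat; lia.
  by rewrite mulrBl S -nl; ring.
Qed.

Lemma sum_poisson_deviation_cvg lambda : (0 < lambda)%N ->
  (\sum_(k <oo) (`|k%:R - lambda%:R| * poisson_pmf (lambda%:R : R) k)%:E =
   (2 * lambda%:R * poisson_pmf (lambda%:R : R) lambda)%:E)%E.
Proof.
move=> l0; apply: nneseries_EFin_cvg; rewrite -cvg_shiftS /=.
have : 2 * lambda%:R * poisson_pmf lambda%:R lambda
       - lambda%:R * poisson_pmf lambda%:R n @[n --> \oo] -->
    2 * lambda%:R * poisson_pmf (lambda%:R : R) lambda - lambda%:R * 0.
  by apply: cvgB; [exact: cvg_cst|apply: cvgMr; exact: poisson_pmf_cvg0].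
rewrite mulr0 subr0; apply: cvg_trans; apply: near_eq_cvg; near=> n.
rewrite sum_poisson_deviation// ifF//; apply/negbTE; rewrite -ltnNge.
by near: n; exists lambda.+1.
Unshelve. all: by end_near. Qed.

Context d (T : measurableType d) (P : probability T R).

(** The masses sum to 1, so the fibres over the naturals cover all but a null set, and the integrand
    is constant on each fibre. *)
Lemma integral_nat_valued (X : {RV P >-> R}) (p : nat -> R) (g : R -> R) :
  (forall k, P (X @^-1` [set k%:R]) = (p k)%:E) ->
  (\sum_(k <oo) (p k)%:E = 1)%E ->
  measurable_fun setT g -> (forall x, 0 <= g x) ->
  (\int[P]_w (g (X w))%:E = \sum_(k <oo) (g k%:R * p k)%:E)%E.
Proof.
move=> Pp p1 mg g0.
pose F k := X @^-1` [set k%:R].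
have mF k : measurable (F k) by exact: measurable_funPTI.
have tF : trivIset setT F.
  move=> i j _ _ [w [/= Xi Xj]]; apply/eqP.
  by rewrite -(eqr_nat R) -Xi -Xj.
have mD : measurable (\bigcup_k F k) by exact: bigcup_measurable.
have PD : P (\bigcup_k F k) = 1%E.
  rewrite measure_semi_bigcup// -p1; apply: eq_eseriesr => k _; exact: Pp.
have mgX : measurable_fun setT (fun w => (g (X w))%:E).
  by apply/measurable_EFinP; exact: measurableT_comp.
rewrite (ge0_negligible_integral (measurableC mD))//; first last.
- by have := probability_setC P mD; rewrite PD subee.
- by move=> w _; rewrite lee_fin.
rewrite setTD setCK ge0_integral_bigcup//; last 2 first.
- exact: measurable_funTS.
- by move=> w _; rewrite lee_fin.
apply: eq_eseriesr => k _.
rewrite (eq_integral (cst (g k%:R)%:E)); last first.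
  by move=> w /set_mem; rewrite /F /= => ->.
by rewrite integral_cst// EFinM; congr (_ * _)%E; exact: Pp.
Qed.

Lemma poisson_mean_absolute_deviation (X : {RV P >-> R}) lambda :
  (0 < lambda)%N -> poisson_distributed X lambda%:R ->
  ('E_P[(fun w => `|X w - lambda%:R|)%R] =
   (2 * lambda%:R * poisson_pmf (lambda%:R : R) lambda)%:E)%E.
Proof.
move=> l0 hX; rewrite unlock -sum_poisson_deviation_cvg//.
apply: (@integral_nat_valued X (poisson_pmf lambda%:R)
  (fun x => `|x - lambda%:R|)) => //.
- by move=> k; rewrite -hX /pmf fineK// fin_num_measure.
- exact: poisson_pmf_sum.
- by apply: measurableT_comp => //; exact: measurable_funB.
Qed.

End poisson_mean_absolute_deviation.

(** * The logarithmic ratio equals minus Binet's function *)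

Section poisson_log_mad_ratio.
Context {R : realType} d (T : measurableType d) (P : probability T R).

Lemma ln_sqrt (x : R) : 0 < x -> ln (Num.sqrt x) = ln x / 2.
Proof.
move=> x0; rewrite -{2}(sqr_sqrtr (ltW x0)) lnXn ?sqrtr_gt0//.
by rewrite mulr2n; field.
Qed.

Lemma log_mad_ratioE (X : {RV P >-> R}) (lambda : nat) : (0 < lambda)%N ->
  poisson_distributed X lambda%:R ->
  log_mad_ratio X lambda%:R = - fine (binet (lambda%:R : R)).
Proof.
move=> l0 hX; have L0 : 0 < lambda%:R :> R by rewrite ltr0n.
have p0 := pi_gt0 R; have two0 : 0 < 2 :> R by [].
have f0 : 0 < lambda`!%:R :> R by rewrite ltr0n fact_gt0.
rewrite /log_mad_ratio poisson_mean_absolute_deviation//= poisson_pmfE//.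
rewrite /exp_coeff/=.
have a0 : 0 < 2 * lambda%:R :> R by exact: mulr_gt0.
have b0 : 0 < lambda%:R ^+ lambda :> R by exact: exprn_gt0.
have c0 : 0 < lambda%:R ^+ lambda / lambda`!%:R :> R by exact: divr_gt0.
have e0 := expR_gt0 (- lambda%:R : R).
have s0 : 0 < 2 * lambda%:R / pi :> R by exact: divr_gt0.
(* Every logarithm is split into those of [2], [pi], [lambda] and [lambda!]; after Stirling's
   formula all terms but the remainder cancel. *)
rewrite (ln_div (mulr_gt0 a0 (mulr_gt0 c0 e0))) ?posrE ?sqrtr_gt0//.
rewrite (lnM a0 (mulr_gt0 c0 e0)) (lnM c0 e0) (ln_div b0 f0) (lnXn _ L0) expRK.
rewrite ln_sqrt// (ln_div a0 p0) (lnM two0 L0) stirling_binet// (lnM two0 p0).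
rewrite -(mulr_natl (ln _) lambda).
move: (fine _) (ln 2) (ln pi) (ln lambda%:R) => b l2 lp l.
by field.
Qed.

End poisson_log_mad_ratio.

(** * The coefficients at zero, and the theorem *)

Section acoef.
Context {R : realType} (B : nat -> {poly R}) (hB : bernoulli_polynomials B).

(** The Bernoulli index is [2 j + 1], odd and at least 3. *)
Lemma acoef_even j : (1 <= j)%N -> acoef B (2 * j) 0 = 0.
Proof.
case: j => [//|j] _; rewrite /acoef.
rewrite (_ : (2 * j.+1).+1 = 2 * j + 3)%N; last by lia.
by have := bernoulli_number_odd B j hB; rewrite /bernoulli_number => ->; rewrite mul0r oppr0.
Qed.

Lemma acoef_odd j : (1 <= j)%N -> acoef B (2 * j - 1) 0 =
  - (bernoulli_number B (2 * j) / ((2 * j - 1) * (2 * j))%:R).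
Proof. by move=> j0; rewrite /acoef (_ : (2 * j - 1).+1 = 2 * j)%N//; lia. Qed.

(** The denominator [(2 j + 1) (2 j + 2)] reduces the factorial [(2 j + 2)!] of the Bernoulli number
    to [(2 j)!]. *)
Lemma acoef_odd_varphi_coef j :
  acoef B (2 * j.+1 - 1) 0 = - ((-1) ^+ j * varphi_coef j * (2 * j)`!%:R).
Proof.
rewrite acoef_odd// (_ : 2 * j.+1 = 2 * j + 2)%N; last by lia.
rewrite bernoulli_number_even// addn2 subn1 /= !factS !natrM.
have : (2 * j).+1%:R != 0 :> R by rewrite pnatr_eq0.
have : (2 * j).+2%:R != 0 :> R by rewrite pnatr_eq0.
move: ((2 * j).+2%:R : R) ((2 * j).+1%:R : R) ((2 * j)`!%:R : R) (_ ^+ j).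
by move=> a b c e a0 b0; field; rewrite a0 b0.
Qed.

Lemma sum_acoef_odd (M : nat) (x : R) :
  \sum_(1 <= j < M.+1) acoef B (2 * j - 1) 0 / x ^+ (2 * j - 1) =
  - \sum_(j < M) (-1) ^+ j * (varphi_coef j * ((2 * j)`!%:R / x ^+ (2 * j).+1)).
Proof.
rewrite big_add1 /= big_mkord -sumrN; apply: eq_bigr => j _.
rewrite acoef_odd_varphi_coef (_ : 2 * j.+1 - 1 = (2 * j).+1)%N; last by lia.
by rewrite mulNr !mulrA.
Qed.

End acoef.

Theorem theorem4p4 (R : realType) (B : nat -> {poly R})
    (hB : bernoulli_polynomials B)
    (d : measure_display) (T : measurableType d) (P : probability T R)
    (lambda : nat) (hlambda : (1 <= lambda)%N)
    (X : {RV P >-> R}) (hX : poisson_distributed X lambda%:R) :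
  [/\ (log_mad_ratio X lambda%:R)%:E = (- binet (lambda%:R : R))%E /\
      (- binet (lambda%:R : R))%E =
        (\int[lebesgue_measure]_(t in `]0%R, +oo[)
           (varphi t * - expR (- (lambda%:R * t)))%:E)%E,
      forall j : nat, (1 <= j)%N -> acoef B (2 * j) 0 = 0,
      forall j : nat, (1 <= j)%N ->
        acoef B (2 * j - 1) 0 =
          - (bernoulli_number B (2 * j) / ((2 * j - 1) * (2 * j))%:R)
    & forall M : nat,
        0 < (-1) ^+ M.+1 *
            (log_mad_ratio X lambda%:R -
             \sum_(1 <= j < M.+1)
               acoef B (2 * j - 1) 0 / lambda%:R ^+ (2 * j - 1))].
Proof.
have l0 : 0 < lambda%:R :> R by rewrite ltr0n.
have logE := log_mad_ratioE _ _ _ X lambda hlambda hX.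
split.
- split; first by rewrite logE EFinN fineK// binet_fin_num.
  rewrite /binet -integral_ge0N; last first.
    move=> t; rewrite /= in_itv/= andbT => t0.
    by rewrite lee_fin mulr_ge0 ?expR_ge0// ltW// varphi_gt0.
  by apply: eq_integral => t _; rewrite -EFinN mulrN.
- exact: acoef_even.
- exact: acoef_odd.
(* The bracket is [- (-1)^M] times the real value of [binet_rem M]; the outer sign turns it into
   that positive number itself. *)
- move=> M; rewrite logE sum_acoef_odd// (binet_expansion M _ l0) opprK.
  rewrite opprD addrAC addNr add0r mulrN exprS mulN1r mulNr opprK mulrA.
  rewrite -expr2 sqrr_sign mul1r fine_gt0// binet_rem_gt0/=.
  by rewrite ltey_eq binet_rem_fin_num.
Qed.
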